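(* For any two non-empty finite sets of primes $P_1$ and $P_2$, there exists a network $\mathcal{N}$ such that $P(\mathcal{N},2)=P_1$ and $P(\mathcal{N},3)=P_1\cup P_2$.
   Context: A network is a finite directed acyclic multigraph whose nodes are partitioned into sources (no incoming edges), terminals (no outgoing edges) and intermediate nodes; each terminal demands the messages of a specified set of sources. For a positive integer $d$ and a finite field $F$, a $d$-dimensional vector linear network code (VLNC) over $F$ works as follows: each source $s$ generates a message $x_s\in F^d$ (messages of different sources are independent and arbitrary); each edge $e$ carries a vector $y_e\in F^d$, where $y_e=Ax_s$ for some $d\times d$ matrix $A$ over $F$ if the tail of $e$ is a source $s$, and $y_e=\sum_{e'} A_{e',e}y_{e'}$ (sum over edges $e'$ entering the tail of $e$, with $d\times d$ matrices $A_{e',e}$ over $F$) if the tail of $e$ is an intermediate node; each terminal $t$ computes vectors of the form $\sum_{e} B_e y_e$ (sum over edges $e$ entering $t$, with fixed $d\times d$ matrices $B_e$). The code is a $d$-dimensional VLNC solution over $F$ if for all choices of source messages every terminal computes each of its demanded messages. For a network $\mathcal{N}$, a positive integer $d$ and a set $S$ of primes, we write $P(\mathcal{N},d)=S$ to mean: for every finite field $F$, $\mathcal{N}$ has a $d$-dimensional VLNC solution over $F$ if and only if the characteristic of $F$ belongs to $S$. *)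

(* Defs.v *)
From HB Require Import structures.
From mathcomp Require Import all_boot all_order all_algebra all_field.
Set Implicit Arguments. Unset Strict Implicit. Unset Printing Implicit Defensive.
Import GRing.Theory.
Local Open Scope ring_scope.

Inductive node_kind := Source | Intermediate | Terminal.

Definition node_kind_eqb (a b : node_kind) : bool :=
  match a, b with
  | Source, Source | Intermediate, Intermediate | Terminal, Terminal => true
  | _, _ => false
  end.

(* A network: finitely many nodes 'I_nv and finitely many (parallel edges
   allowed) edges 'I_ne, each edge e going from [tail e] to [head e];
   every node has a kind; [demands t s] means terminal t demands the
   message of source s. *)
Record network := Network {
  nv : nat;
  ne : nat;
  tail : 'I_ne -> 'I_nv;
  head : 'I_ne -> 'I_nv;
  kind : 'I_nv -> node_kind;
  demands : 'I_nv -> 'I_nv -> bool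
}.

Definition acyclic (N : network) : Prop :=
  exists r : 'I_(nv N) -> nat, forall e : 'I_(ne N), (r (tail e) < r (head e))%N.

Definition wf_network (N : network) : Prop :=
  [/\ acyclic N,
      (forall e : 'I_(ne N), kind (head e) <> Source),
      (forall e : 'I_(ne N), kind (tail e) <> Terminal)
    & (forall t s : 'I_(nv N), demands t s -> kind t = Terminal /\ kind s = Source)].

Record vlnc (N : network) (d : nat) (F : finFieldType) := VLNC {
  (* A_e : used when the tail of e is a source: y_e = A_e x_(tail e) *)
  src_coef : 'I_(ne N) -> 'M[F]_d;
  (* A_(e',e) : used when the tail of e is intermediate:
     y_e = sum_(e' entering tail e) A_(e',e) y_e' *)
  int_coef : 'I_(ne N) -> 'I_(ne N) -> 'M[F]_d;
  (* B_(t,s,e) : terminal t recovers x_s as sum_(e entering t) B_(t,s,e) y_e *)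
  dec_coef : 'I_(nv N) -> 'I_(nv N) -> 'I_(ne N) -> 'M[F]_d
}.

Definition edge_consistent (N : network) (d : nat) (F : finFieldType)
    (C : vlnc N d F) (x : 'I_(nv N) -> 'cV[F]_d) (y : 'I_(ne N) -> 'cV[F]_d)
    : Prop :=
  forall e : 'I_(ne N),
    if node_kind_eqb (kind (tail e)) Source
    then y e = src_coef C e *m x (tail e)
    else y e = \sum_(e' : 'I_(ne N) | head e' == tail e) int_coef C e' e *m y e'.

Definition is_vlnc_solution (N : network) (d : nat) (F : finFieldType)
    (C : vlnc N d F) : Prop :=
  forall (x : 'I_(nv N) -> 'cV[F]_d) (y : 'I_(ne N) -> 'cV[F]_d),
    edge_consistent C x y ->
    forall t s : 'I_(nv N), demands t s ->
      \sum_(e : 'I_(ne N) | head e == t) dec_coef C t s e *m y e = x s.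

Definition has_vlnc_solution (N : network) (d : nat) (F : finFieldType) : Prop :=
  exists C : vlnc N d F, is_vlnc_solution C.

Definition solvability_chars (N : network) (d : nat) (S : seq nat) : Prop :=
  forall F : finFieldType,
    has_vlnc_solution N d F <-> exists2 p : nat, p \in S & p \in [pchar F].

(* Main.v *)
(** The network is a disjoint union of two parts.  Over a field where n = 0,
    the sum of the n + 1 signals y_i = w - x_i, with w = x_0 + ... + x_n + h,
    equals h; over any other field no nonzero linear combination of the y_i is
    free of the x_k.  With n the product of all primes of P1 and P2 and h a demanded
    message, this gives a network solvable exactly in these characteristics.

    In the other part, terminal (i, j) demands a_i and c_j (i, j < 3); it
    receives one signal p mixing the a's, two signals r_0, r_1 mixing the c's
    and one signal mixing a_i with c_j.  In dimension 3, p can carry a third of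
    every a_i, and r_0, r_1 two thirds of every c_j.  In dimension 2, p reveals
    nothing about some a_i, so the last signal is used up by this a_i, and all
    three c_j have to be decoded from r_0 and r_1, which is impossible.  A third
    signal mixing the c's makes the problem trivially solvable; it is supplied
    by a gadget as above, with n the product of the primes of P1. *)
Require Import Defs.
From HB Require Import structures.
From mathcomp Require Import all_boot all_order all_algebra all_field.

Set Implicit Arguments. Unset Strict Implicit. Unset Printing Implicit Defensive.
Import GRing.Theory.
Local Open Scope ring_scope.

Lemma big_option (R : nmodType) (I : finType) (P : pred (option I)) (f : option I -> R) :
  \sum_(o | P o) f o = (if P None then f None else 0) + \sum_(i | P (Some i)) f (Some i).
Proof.
rewrite big_mkcond (bigD1 None) //=; congr (_ + _).
rewrite [RHS]big_mkcond (reindex_omap Some id) /=; last by case.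
by apply: eq_bigl => i; rewrite eqxx.
Qed.

(* Encodes the networks in which every source feeds some single-edge bottlenecks
   [var], with incidence [inc], and every terminal hears the bottlenecks selected
   by [acc] and demands one message. *)
Record pattern := Pattern {
  src : finType;
  var : finType;
  term : finType;
  inc : var -> src -> bool;
  acc : term -> var -> bool;
  dem : term -> src
}.

(** Solvability as an identity of end-to-end transfer matrices, with encoders [G] at the bottlenecks
    and decoders [D] at the terminals. *)
Definition solvable (B : pattern) d (F : fieldType) : Prop :=
  exists (G : var B -> src B -> 'M[F]_d) (D : term B -> var B -> 'M[F]_d),
  forall t s, \sum_(v | acc t v && inc v s) D t v *m G v s = (s == dem t)%:R%:M.

(** * The network of a pattern *)

Section Network.
Variable B : pattern.

(* The source [None] is demanded by no terminal: an edge starting there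
   stands for an absent edge. *)
Definition node : finType := (option (src B) + var B + (var B + term B))%type.
(** Three layers: into the entrance of a bottleneck, across it, and from its exit to a terminal. *)
Definition edge : finType := (var B * src B + var B + term B * var B)%type.

Definition src_node s : node := inl (inl s).
Definition in_node v : node := inl (inr v).
Definition out_node v : node := inr (inl v).
Definition term_node t : node := inr (inr t).

Definition edge_tail (e : edge) : node :=
  match e with
  | inl (inl (v, s)) => src_node (if inc v s then Some s else None)
  | inl (inr v) => in_node v
  | inr (t, v) => if acc t v then out_node v else src_node None
  end.

Definition edge_head (e : edge) : node :=
  match e with
  | inl (inl (v, s)) => in_node v
  | inl (inr v) => out_node v
  | inr (t, v) => term_node t
  end.

Definition kind_of_node (x : node) : Defs.node_kind :=
  match x with
  | inl (inl _) => Source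
  | inr (inr _) => Terminal
  | _ => Intermediate
  end.

Definition node_demands (x y : node) : bool :=
  match x, y with
  | inr (inr t), inl (inl (Some s)) => s == dem t
  | _, _ => false
  end.

Definition net : network :=
  @Network #|node| #|edge|
    (fun e => enum_rank (edge_tail (enum_val e)))
    (fun e => enum_rank (edge_head (enum_val e)))
    (fun x => kind_of_node (enum_val x))
    (fun x y => node_demands (enum_val x) (enum_val y)).

Lemma net_wf : wf_network net.
Proof.
split=> [|e|e|t s] /=.
- exists (fun x => match enum_val x with
    | inl (inl _) => 0 | inl (inr _) => 1 | inr (inl _) => 2 | inr (inr _) => 3
    end)%N => e /=; rewrite !enum_rankK.
  case: (enum_val e) => [[[v s]|v]|[t v]] //=; by case: ifP.
- by rewrite enum_rankK; case: (enum_val e) => [[[v s]|v]|[t v]].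
- by rewrite enum_rankK; case: (enum_val e) => [[[v s]|v]|[t v]] //=; case: ifP.
- by case: (enum_val t) => [[?|?]|[?|?]]; case: (enum_val s) => [[[?|]|?]|[?|?]].
Qed.

Section Solution.
Variables (d : nat) (F : finFieldType).

Lemma sum_edges_into (x : node) (f : 'I_(ne net) -> 'cV[F]_d) :
  \sum_(e : 'I_(ne net) | Defs.head e == enum_rank x) f e =
  \sum_(e | edge_head e == x) f (enum_rank e).
Proof.
under eq_bigl do rewrite (inj_eq enum_rank_inj).
rewrite [RHS](reindex _ (onW_bij _ (enum_val_bij edge))) /=.
by apply: eq_bigr => e _; rewrite enum_valK.
Qed.

Lemma sum_into_in v (f : edge -> 'cV[F]_d) :
  \sum_(e | edge_head e == in_node v) f e = \sum_s f (inl (inl (v, s))).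
Proof.
rewrite 2!big_sumType /= [X in _ + X + _]big_pred0; last by [].
rewrite [X in _ + _ + X]big_pred0; last by case.
rewrite !addr0.
transitivity (\sum_(v' | v' == v) \sum_s f (inl (inl (v', s)))); last exact: big_pred1_eq.
by rewrite pair_big; apply: eq_big => [[v' s]|[v' s]] //=; rewrite andbT.
Qed.

Lemma sum_into_out v (f : edge -> 'cV[F]_d) :
  \sum_(e | edge_head e == out_node v) f e = f (inl (inr v)).
Proof.
rewrite 2!big_sumType /= [X in X + _ + _]big_pred0; last by case.
rewrite [X in _ + _ + X]big_pred0; last by case.
by rewrite addr0 add0r (big_pred1 v).
Qed.

Lemma sum_into_term t (f : edge -> 'cV[F]_d) :
  \sum_(e | edge_head e == term_node t) f e = \sum_v f (inr (t, v)).
Proof.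
rewrite 2!big_sumType /= [X in X + _ + _]big_pred0; last by case.
rewrite [X in _ + X + _]big_pred0; last by [].
rewrite !add0r.
transitivity (\sum_(t' | t' == t) \sum_v f (inr (t', v))); last exact: big_pred1_eq.
by rewrite pair_big; apply: eq_big => [[t' v]|[t' v]] //=; rewrite andbT.
Qed.

Lemma solvable_net : solvable B d F -> has_vlnc_solution net d F.
Proof.
move=> [G [D GD]].
pose A (e : edge) := if e is inl (inl (v, s)) then G v s else 0.
(* All encoding sits on the source edges and the bottleneck merely adds; the factor [inc v s]
   discards what stand-in edges carry from the dummy source. *)
pose K (e' e : edge) : 'M[F]_d :=
  match e', e with
  | inl (inl (v, s)), inl (inr v') => (inc v s)%:R%:M
  | inl (inr v), inr (t, v') => 1%:M
  | _, _ => 0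
  end.
pose C (x y : node) (e : edge) :=
  match x, e with
  | inr (inr t), inr (t', v) => if acc t v then D t v else 0
  | _, _ => 0
  end.
exists (@VLNC net d F (fun e => A (enum_val e))
  (fun e' e => K (enum_val e') (enum_val e))
  (fun x y e => C (enum_val x) (enum_val y) (enum_val e))).
move=> x y xy t s.
have {xy} xyE (e : edge) : if edge_tail e is inl (inl s')
    then y (enum_rank e) = A e *m x (enum_rank (edge_tail e))
    else y (enum_rank e) = \sum_(e' | edge_head e' == edge_tail e)
                   K e' e *m y (enum_rank e').
  have := xy (enum_rank e); rewrite /= !enum_rankK.
  rewrite sum_edges_into.
  under [in X in X -> _]eq_bigr do rewrite enum_rankK.
  by case: (edge_tail e) => [[]|[]].
rewrite -(enum_valK t) -(enum_valK s) /= !enum_rankK.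
case: (enum_val t) => [[?|?]|[?|{}t]] //; case: (enum_val s) => [[[{}s|]|?]|?] //= sE.
rewrite (sum_edges_into (term_node t)) sum_into_term.
under eq_bigr do rewrite enum_rankK /=.
have yS v s' : inc v s' -> y (enum_rank (inl (inl (v, s')) : edge)) =
    G v s' *m x (enum_rank (src_node (Some s'))).
  by move=> vs; have := xyE (inl (inl (v, s'))); rewrite /= vs.
have yV v : y (enum_rank (inl (inr v) : edge)) =
    \sum_(s' | inc v s') G v s' *m x (enum_rank (src_node (Some s'))).
  have /= -> := xyE (inl (inr v)); rewrite sum_into_in [RHS]big_mkcond.
  apply: eq_bigr => s' _ /=; case: ifP => [/yS->|_]; first by rewrite mul1mx.
  by rewrite raddf0 mul0mx.
have yT v : acc t v -> y (enum_rank (inr (t, v) : edge)) =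
    y (enum_rank (inl (inr v) : edge)).
  move=> tv; have := xyE (inr (t, v)); rewrite /= tv /= => ->.
  by rewrite sum_into_out mul1mx.
transitivity (\sum_s' (\sum_(v | acc t v && inc v s') D t v *m G v s')
    *m x (enum_rank (src_node (Some s')))).
  under [RHS]eq_bigr do rewrite mulmx_suml big_mkcondr /= big_mkcond /=.
  rewrite exchange_big; apply: eq_bigr => v _ /=.
  case: ifP => [tv|_]; last by rewrite mul0mx big1.
  rewrite yT // yV mulmx_sumr [LHS]big_mkcond; apply: eq_bigr => s' _.
  by rewrite mulmxA.
rewrite (bigD1 s) //= GD sE mul1mx big1 ?addr0 // => s' /negPf s's.
by rewrite GD -(eqP sE) s's raddf0 mul0mx.
Qed.

Lemma net_solvable : has_vlnc_solution net d F -> solvable B d F.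
Proof.
move=> [C solC].
pose eVS v s : 'I_(ne net) := enum_rank (inl (inl (v, s)) : edge).
pose eV v : 'I_(ne net) := enum_rank (inl (inr v) : edge).
pose eTV t v : 'I_(ne net) := enum_rank (inr (t, v) : edge).
pose G v s := int_coef C (eVS v s) (eV v) *m src_coef C (eVS v s).
pose D t v := dec_coef C (enum_rank (term_node t))
    (enum_rank (src_node (Some (dem t)))) (eTV t v)
  *m int_coef C (eV v) (eTV t v).
exists G, D => t s.
(* Column [i] of the transfer matrix is the response to the [i]-th unit vector at source [s]. All
   other sources, including the dummy one, stay silent, so stand-in edges carry 0. *)
apply/trmx_inj/row_matrixP => i; apply/trmx_inj; rewrite !tr_row !trmxK.
rewrite !colE; set u : 'cV_d := delta_mx i 0.
pose x (n : 'I_(nv net)) : 'cV[F]_d := if n == enum_rank (src_node (Some s)) then u else 0.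
pose yS v s' : 'cV[F]_d := src_coef C (eVS v s') *m (if inc v s' && (s' == s) then u else 0).
pose yV v := \sum_s' int_coef C (eVS v s') (eV v) *m yS v s'.
pose y (e : 'I_(ne net)) : 'cV[F]_d := match (enum_val e : edge) with
  | inl (inl (v, s')) => yS v s'
  | inl (inr v) => yV v
  | inr (t, v) => if acc t v then int_coef C (eV v) e *m yV v else 0
  end.
have yVE v : yV v = (if inc v s then G v s else 0) *m u.
  rewrite /yV (bigD1 s) //= big1 ?addr0 /yS ?eqxx ?andbT.
    by case: ifP => _; rewrite /G ?mulmx0 ?mul0mx ?mulmx0 // mulmxA.
  by move=> s' /negPf->; rewrite andbF !mulmx0.
have xy : edge_consistent C x y.
  move=> e; rewrite -[e]enum_valK; move: (enum_val e) => {}e /=.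
  rewrite !enum_rankK /y enum_rankK -/edge.
  rewrite sum_edges_into.
  case: e => [[[v s']|v]|[t' v]] /=.
  - by rewrite /yS /x (inj_eq enum_rank_inj); case: (inc v s').
  - by rewrite (sum_into_in v); apply: eq_bigr => s' _; rewrite enum_rankK.
  - case: (acc t' v) => /=; first by rewrite (sum_into_out v) enum_rankK.
    by rewrite /x (inj_eq enum_rank_inj) mulmx0.
have := solC x y xy (enum_rank (term_node t)) (enum_rank (src_node (Some (dem t)))).
rewrite /= !enum_rankK /= eqxx => /(_ isT).
rewrite sum_edges_into sum_into_term /x (inj_eq enum_rank_inj).
have -> : (src_node (Some (dem t)) == src_node (Some s)) = (s == dem t).
  by rewrite [RHS]eq_sym.
have -> : (s == dem t)%:R%:M *m u = if s == dem t then u else 0.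
  by case: ifP => _; rewrite ?mul1mx // raddf0 mul0mx.
move <-; rewrite mulmx_suml [LHS]big_mkcond; apply: eq_bigr => v _.
rewrite /y enum_rankK yVE; case: (acc t v); last by rewrite mulmx0.
case: (inc v s); last by rewrite mul0mx !mulmx0.
by rewrite /= /D !mulmxA.
Qed.

End Solution.
End Network.

(** * Disjoint unions and the characteristic gadget *)

Definition punion (B1 B2 : pattern) : pattern :=
  @Pattern (src B1 + src B2)%type (var B1 + var B2)%type (term B1 + term B2)%type
    (fun v s => match v, s with
       | inl v, inl s => inc v s | inr v, inr s => inc v s | _, _ => false end)
    (fun t v => match t, v with
       | inl t, inl v => acc t v | inr t, inr v => acc t v | _, _ => false end)
    (fun t => match t with inl t => inl (dem t) | inr t => inr (dem t) end).

Lemma solvable_union B1 B2 d F :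
  solvable (punion B1 B2) d F <-> solvable B1 d F /\ solvable B2 d F.
Proof.
split=> [[G [D GD]] | [[G1 [D1 GD1]] [G2 [D2 GD2]]]].
  split.
    exists (fun v s => G (inl v) (inl s)), (fun t v => D (inl t) (inl v)) => t s.
    by rewrite -[RHS](GD (inl t) (inl s)) big_sumType /= [X in _ = _ + X]big_pred0 ?addr0.
  exists (fun v s => G (inr v) (inr s)), (fun t v => D (inr t) (inr v)) => t s.
  by rewrite -[RHS](GD (inr t) (inr s)) big_sumType /= [X in _ = X + _]big_pred0 ?add0r.
exists (fun v s => match v, s with
    | inl v, inl s => G1 v s | inr v, inr s => G2 v s | _, _ => 0 end),
  (fun t v => match t, v with
    | inl t, inl v => D1 t v | inr t, inr v => D2 t v | _, _ => 0 end).
move=> [t|t] [s|s]; rewrite big_sumType /=.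
- by rewrite [X in _ + X]big_pred0 // addr0 GD1.
- by rewrite !big_pred0 ?addr0 ?raddf0 // => v; rewrite andbF.
- by rewrite !big_pred0 ?addr0 ?raddf0 // => v; rewrite andbF.
- by rewrite [X in X + _]big_pred0 // add0r GD2.
Qed.

(* The y_i factor through invertible K_i as y_i = K_i (w - x_i); a relation between
   them makes every c_i K_i equal to the sum S of all of them, so S = (n + 1) S. *)
Lemma invertible_gadget_relation n d (F : fieldType)
    (w : 'I_n.+1 -> 'M[F]_d) (y : 'I_n.+1 -> 'I_n.+1 -> 'M[F]_d)
    (D E : 'I_n.+1 -> 'M[F]_d) (c : 'I_n.+1 -> 'M[F]_d) :
    n%:R != 0 :> F ->
    (forall i, D i *m w i = 1%:M) ->
    (forall i k, i != k -> D i *m w k + E i *m y i k = 0) ->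
    (forall k, \sum_(i | i != k) c i *m y i k = 0) ->
  forall i, c i = 0.
Proof.
move=> n0 Dw DwEy cy0.
have wU k : w k \in unitmx by have [] := mulmx1_unit (Dw k).
have DU k : D k \in unitmx by have [] := mulmx1_unit (Dw k).
have EU i : E i \in unitmx.
  (* A second index [k] exists because [n] is nonzero in [F]; then [E i *m y i k] is minus a product
     of invertible matrices. *)
  have n_gt0 : (0 < n)%N.
    by case: n n0 {w y D E c Dw DwEy cy0 wU DU} i; rewrite ?eqxx.
  have [k ik] : exists k, i != k.
    case: (eqVneq i ord0) => [->|]; last by exists ord0.
    by exists ord_max; rewrite -val_eqE /= neq_ltn n_gt0.
  have /eqP := DwEy i k ik; rewrite addrC addr_eq0 => /eqP Ey.
  have : E i *m (y i k *m (- (invmx (w k) *m invmx (D i)))) = 1%:M.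
    by rewrite mulmxA Ey mulmxN mulNmx opprK mulmxA mulmxK // mulmxV.
  by case/mulmx1_unit.
pose K i := - (invmx (E i) *m D i).
have yK i k : i != k -> y i k = K i *m w k.
  move=> /DwEy/eqP; rewrite addrC addr_eq0 => /eqP Ey.
  by rewrite -[LHS](mulKmx (EU i)) Ey mulmxN mulNmx mulmxA.
pose S := \sum_i c i *m K i.
have cK k : c k *m K k = S.
  have : (\sum_(i | i != k) c i *m K i) *m w k = 0.
    by rewrite mulmx_suml -[RHS](cy0 k); apply: eq_bigr => i ik; rewrite yK // mulmxA.
  move=> /(congr1 (mulmx^~ (invmx (w k)))); rewrite mulmxK // mul0mx => Sk.
  by rewrite /S (bigD1 k) //= Sk addr0.
have S0 : S = 0.
  have : S = S *+ n.+1.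
    by rewrite {1}/S (eq_bigr (fun=> S)) ?sumr_const ?card_ord.
  rewrite mulrS => /eqP; rewrite -subr_eq0 opprD addNKr oppr_eq0.
  by rewrite -scaler_nat scaler_eq0 (negPf n0) => /eqP.
have KU i : K i \in unitmx.
  by rewrite /K -mulNmx unitmx_mul DU andbT -scaleN1r unitmxZ ?unitmx_inv ?unitrN ?unitr1.
by move=> i; rewrite -[LHS](mulmxK (KU i)) cK S0 mul0mx.
Qed.

(* Signal [None] is w, signal [Some i] is y_i; a new terminal i checks that y_i is
   w minus the contribution of x_i, up to invertible factors. *)
Definition gadget n (B : pattern) : pattern :=
  @Pattern ('I_n.+1 + src B)%type (option 'I_n.+1 + var B)%type ('I_n.+1 + term B)%type
    (fun v s => match v, s with
       | inl (Some i), inl k => i != k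
       | inl _, _ => true
       | inr v, inr s => inc v s
       | inr _, inl _ => false end)
    (fun t v => match t, v with
       | inl i, inl (Some k) => i == k
       | inl _, inl None => true
       | inl _, inr _ => false
       | inr _, inl o => isSome o
       | inr t, inr v => acc t v end)
    (fun t => match t with inl i => inl i | inr t => inr (dem t) end).

(* When n = 0 in F, every terminal of B gains one more signal, with coefficients
   [H], decoded through [K]. *)
Lemma gadget_solvable n B d (F : fieldType)
    (G : var B -> src B -> 'M[F]_d) (D : term B -> var B -> 'M[F]_d)
    (H : src B -> 'M[F]_d) (K : term B -> 'M[F]_d) :
    (forall t, K t *+ n = 0) ->
    (forall t s, \sum_(v | acc t v && inc v s) D t v *m G v s + K t *m H s
       = (s == dem t)%:R%:M) ->
  solvable (gadget n B) d F.
Proof.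
move=> Kn GD.
(* With unit coefficients, the incidence alone removes x_i from y_i, and terminal [inl i] computes w
   - y_i. *)
exists (fun v s => match v, s with
    | inl _, inl _ => 1%:M
    | inl _, inr s => H s
    | inr v, inr s => G v s
    | inr _, inl _ => 0 end),
  (fun t v => match t, v with
    | inl i, inl None => 1%:M
    | inl _, inl (Some _) => - 1%:M
    | inr t, inl _ => K t
    | inr t, inr v => D t v
    | inl _, inr _ => 0 end).
move=> [i|t] [k|s]; rewrite big_sumType big_option /=.
- rewrite [X in _ + X]big_pred0 // addr0 mulmx1 -[_ == _]/(k == i) eq_sym.
  case: (eqVneq i k) => [->|ik].
    by rewrite big_pred0 ?addr0 // => j; case: eqVneq => //= ->; rewrite eqxx.
  rewrite (big_pred1 i) ?mulmx1 ?subrr ?raddf0 // => j /=.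
  by rewrite eq_sym; case: (eqVneq j i) => //= ->.
- rewrite [X in _ + X]big_pred0 // addr0 mul1mx (big_pred1 i) => [|j]; last first.
    by rewrite /= andbT eq_sym.
  by rewrite mulNmx mul1mx subrr raddf0.
(* Each x_k occurs in [n] of the [n.+1] signals y_i, so it cancels; [H] occurs in all of them and
   survives once. *)
- rewrite [X in _ + X]big_pred0 => [|v]; last by rewrite andbF.
  rewrite addr0 add0r mulmx1 sumr_const raddf0.
  have -> : #|(fun j : 'I_n.+1 => j != k)| = n; last exact: Kn.
  by rewrite -[RHS]/(n.+1.-1) -[in RHS](card_ord n.+1) (cardC1 k).
- rewrite sumr_const card_ord mulrS -scaler_nat scalemxAl scaler_nat Kn.
  by rewrite mul0mx addr0 add0r addrC GD.
Qed.

(** The terminals of [B] have to cancel every x_k, which forces their coefficients on all y_i to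
    vanish; what remains is a code for [B]. *)
Lemma solvable_gadget n B d (F : fieldType) :
  n%:R != 0 :> F -> solvable (gadget n B) d F -> solvable B d F.
Proof.
move=> n0 [G [D GD]].
have Ky t i : D (inr t) (inl (Some i)) = 0.
  pose w k := G (inl None) (inl k); pose y i k := G (inl (Some i)) (inl k).
  apply: (@invertible_gadget_relation n d F w y
    (fun i => D (inl i) (inl None)) (fun i => D (inl i) (inl (Some i)))
    (fun i => D (inr t) (inl (Some i)))) => // [k|j k jk|k].
  - have := GD (inl k) (inl k); rewrite big_sumType big_option /= eqxx => <-.
    rewrite [X in _ = _ + X]big_pred0 // addr0 [X in _ = _ + X]big_pred0 ?addr0 // => j.
    by case: eqVneq => //= ->; rewrite eqxx.
  - have := GD (inl j) (inl k); rewrite big_sumType big_option /= -[_ == _]/(k == j).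
    rewrite eq_sym (negPf jk) raddf0 => E; apply: etrans E.
    rewrite [X in _ = _ + X]big_pred0 // addr0 (big_pred1 j) // => l /=.
    by rewrite eq_sym; case: (eqVneq l j) => //= ->.
  - have := GD (inr t) (inl k); rewrite big_sumType big_option /= raddf0 => E.
    apply: etrans E.
    by rewrite add0r [X in _ = _ + X]big_pred0 ?addr0 // => v; rewrite andbF.
exists (fun v s => G (inr v) (inr s)), (fun t v => D (inr t) (inr v)) => t s.
have := GD (inr t) (inr s); rewrite big_sumType big_option /= add0r big1 ?add0r //.
by move=> i _; rewrite Ky mul0mx.
Qed.

(** * The pattern separating dimensions 2 and 3 *)

(** The blocks form an identity matrix of size [p * d.+1] factoring through size [q * d.+1]; compare
    ranks. Positive block size allows cancelling it. *)
Lemma block_identity_le p q d (F : fieldType)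
    (A : 'I_p -> 'I_q -> 'M[F]_d.+1) (B : 'I_q -> 'I_p -> 'M[F]_d.+1) :
  (forall i k, \sum_j A i j *m B j k = (k == i)%:R%:M) -> (p <= q)%N.
Proof.
move=> AB.
have E : (\mxblock_(i, j) A i j) *m (\mxblock_(j, k) B j k) = 1%:M.
  rewrite mul_mxblock -mxdiagZ; apply/eq_mxblockP => i k; rewrite AB eq_sym.
  by case: eqVneq; rewrite ?conform_mx_id ?raddf0.
have := mxrankM_maxr (\mxblock_(i, j) A i j) (\mxblock_(j, k) B j k).
rewrite E mxrank1 => /leq_trans/(_ (rank_leq_row _)).
by rewrite !sum_nat_const !card_ord leq_pmul2r.
Qed.

(** Otherwise each [i] has a row vector that kills every [P k] except [P i]. These [m > d] vectors
    are dependent, but multiplying a relation by [P i] isolates its [i]-th coefficient, which must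
    be 0. *)
Lemma exists_trivial_component m d (F : fieldType) (P : 'I_m -> 'M[F]_d) :
  (d < m)%N ->
  exists i, forall n (X : 'M[F]_(n, d)),
    (forall k, k != i -> X *m P k = 0) -> X *m P i = 0.
Proof.
move=> dm; pose W i := (\bigcap_(k | k != i) kermx (P k))%MS.
case: (boolP [exists i, (W i <= kermx (P i))%MS]) => [/existsP[i Wi]|].
  exists i => n X XP; apply/sub_kermxP; apply: submx_trans Wi.
  by apply/sub_bigcapmxP => k ki; apply/sub_kermxP/XP.
rewrite negb_exists => /forallP Wn.
have /fin_all_exists2[u uW uP] i : exists2 u : 'rV_d, (u <= W i)%MS & u *m P i != 0.
  have /row_subPn[r rW] := Wn i; exists (row r (W i)); first exact: row_sub.
  by apply: contra rW => /eqP rP; apply/sub_kermxP.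
pose U := \matrix_i u i.
have /rowV0Pn[a /sub_kermxP aU /eqP a0] : kermx U != 0.
  by rewrite kermx_eq0 /row_free neq_ltn (leq_ltn_trans (rank_leq_col _)).
case: a0; apply/rowP => i; rewrite mxE; apply/eqP.
have := congr1 (mulmx^~ (P i)) aU; rewrite mul0mx [a *m U]mulmx_sum_row mulmx_suml.
rewrite (bigD1 i) //= big1 => [|k ki]; rewrite rowK -scalemxAl.
  by rewrite addr0 => /eqP; rewrite scaler_eq0 (negPf (uP i)) orbF.
have /sub_bigcapmxP/(_ i) := uW k; rewrite eq_sym ki => /(_ isT)/sub_kermxP->.
by rewrite scaler0.
Qed.

(* Sources [inl i] and [inr j] are a_i and c_j; signals [inl None] and
   [inl (Some b)] are p and r_b, and [inr (i, j)] mixes a_i with c_j. *)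
Definition base3 : pattern :=
  @Pattern ('I_3 + 'I_3)%type (option 'I_2 + 'I_3 * 'I_3)%type ('I_3 * 'I_3 * bool)%type
    (fun v s => match v, s with
       | inl o, inl _ => ~~ isSome o
       | inl o, inr _ => isSome o
       | inr m, inl i => m.1 == i
       | inr m, inr j => m.2 == j end)
    (fun t v => match v with inl _ => true | inr m => m == t.1 end)
    (fun t => if t.2 then inr t.1.2 else inl t.1.1).

Lemma sum_base3 (R : nmodType) t s (f : var base3 -> R) :
  \sum_(v : var base3 | acc t v && inc v s) f v =
  match s with
  | inl k => f (inl None) + (if t.1.1 == k then f (inr t.1) else 0)
  | inr k => \sum_b f (inl (Some b)) + (if t.1.2 == k then f (inr t.1) else 0)
  end.
Proof.
have E (P : pred ('I_3 * 'I_3)) : \sum_(m | (m == t.1) && P m) f (inr m) =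
    if P t.1 then f (inr t.1) else 0.
  rewrite big_mkcondr /=; exact: big_pred1_eq.
rewrite big_sumType big_option /=; case: s => k /=; last by rewrite add0r E.
by rewrite [X in _ + X + _]big_pred0 ?addr0 // E.
Qed.

(** Coordinate k of p is coordinate 0 of a_k, and coordinate k of r_b is coordinate b of c_k. The
    mixed signal holds the missing pieces: coordinates 1 and 2 of a_i, then coordinate 2 of c_j. *)
Lemma base3_solvable3 (F : fieldType) : solvable base3 3 F.
Proof.
pose e (i j : nat) : 'M[F]_3 := delta_mx (inord i) (inord j).
exists (fun (v : var base3) (s : src base3) => match v, s with
    | inl None, inl k => e k 0%N
    | inl (Some b), inr k => e k b
    | inr _, inl _ => e 0%N 1%N + e 1%N 2%N
    | inr _, inr _ => e 2%N 2%N
    | _, _ => 0 end),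
  (fun (t : term base3) (v : var base3) => match t.2, v with
    | false, inl None => e 0%N t.1.1
    | false, inr _ => e 1%N 0%N + e 2%N 1%N
    | true, inl (Some b) => e b t.1.2
    | true, inr _ => e 2%N 2%N
    | _, _ => 0 end).
have eM i j k l : (i < 3)%N -> (j < 3)%N -> (k < 3)%N -> (l < 3)%N ->
    e i j *m e k l = (j == k)%:R *: e i l.
  move=> i3 j3 k3 l3; rewrite /e; case: (eqVneq j k) => [->|jk].
    by rewrite mul_delta_mx scale1r.
  by rewrite mul_delta_mx_0 ?scale0r // -val_eqE /= !inordK.
have e1 : e 0%N 0%N + e 1%N 1%N + e 2%N 2%N = 1%:M.
  rewrite mx1_sum_delta !big_ord_recl big_ord0 addr0 /e !addrA.
  by do 3?[congr (_ + _)|]; congr delta_mx; apply/val_inj; rewrite /= inordK.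
move=> [[i j] []] s; rewrite sum_base3 /=; case: s => k /=.
- by rewrite mul0mx add0r mulmxDr !eM //= !scale0r addr0 if_same raddf0.
- rewrite !big_ord_recl big_ord0 addr0 !eM ?ltn_ord //= -[_ == inr _]/(k == j).
  rewrite -[(j == k :> nat)]/(j == k) eq_sym; case: (eqVneq k j) => _.
    by rewrite !scale1r -e1.
  by rewrite !scale0r !addr0 raddf0.
- rewrite mulmxDl !mulmxDr !eM ?ltn_ord //= -[_ == inl _]/(k == i).
  rewrite -[(i == k :> nat)]/(i == k) eq_sym; case: (eqVneq k i) => _.
    by rewrite !scale1r !scale0r addr0 add0r addrA e1.
  by rewrite !scale0r !addr0 raddf0.
- rewrite big1 => [|b _]; last by rewrite mul0mx.
  by rewrite add0r mulmxDl !eM //= !scale0r addr0 if_same raddf0.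
Qed.

Lemma solvable_base3_dim2 (F : fieldType) : ~ solvable base3 2 F.
Proof.
move=> [G [D GD]].
have [i P0] := exists_trivial_component (fun k => G (inl None) (inl k)) (ltnSn 2).
have left_eq j b k : D (i, j, b) (inl None) *m G (inl None) (inl k) +
    (if i == k then D (i, j, b) (inr (i, j)) *m G (inr (i, j)) (inl k) else 0)
    = (~~ b && (k == i))%:R%:M.
  by have := GD (i, j, b) (inl k); rewrite sum_base3 /= => ->; case: b.
(* For [k != i], a_k reaches this terminal through p only, so the decoder of p kills it; by the
   choice of [i] it kills a_i too. *)
have p0 j b : D (i, j, b) (inl None) *m G (inl None) (inl i) = 0.
  apply: P0 => k ki; have := left_eq j b k.
  by rewrite eq_sym (negPf ki) addr0 andbF raddf0.
(* The terminal demanding a_i gets it from the mixed signal alone, where its coefficient is thus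
   invertible; the one demanding c_j must then ignore that signal. *)
have m0 j : D (i, j, true) (inr (i, j)) = 0.
  have := left_eq j false i; rewrite p0 eqxx add0r => /mulmx1_unit[_ mU].
  have := left_eq j true i; rewrite p0 eqxx add0r raddf0 => Dm.
  by rewrite -[LHS](mulmxK mU) Dm mul0mx.
suff: (3 <= 2)%N by [].
apply: (@block_identity_le 3 2 1 F (fun j b => D (i, j, true) (inl (Some b)))
  (fun b k => G (inl (Some b)) (inr k))) => j k.
have := GD (i, j, true) (inr k); rewrite sum_base3 /= m0 mul0mx if_same addr0.
by move->.
Qed.

(** The gadget delivers c_2 while r_0 and r_1 deliver c_0 and c_1, so the mixed signal can carry a_i
    alone and p can be 0. *)
Lemma gadget_base3_solvable n d (F : fieldType) :
  n%:R = 0 :> F -> solvable (gadget n base3) d F.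
Proof.
move=> n0.
apply: (@gadget_solvable n base3 d F (fun v s => match v, s with
    | inl (Some b), inr k => (k == b :> nat)%:R%:M
    | inr _, inl _ => 1%:M
    | _, _ => 0 end)
  (fun t v => match t.2, v with
    | false, inr _ => 1%:M
    | true, inl (Some b) => (t.1.2 == b :> nat)%:R%:M
    | _, _ => 0 end)
  (fun s => if s is inr k then (k == 2 :> nat)%:R%:M else 0)
  (fun t => if t.2 then (t.1.2 == 2 :> nat)%:R%:M else 0)).
  by move=> [[i j] [] /=]; rewrite -scaler_nat n0 scale0r.
move=> [[i j] []] s; rewrite sum_base3 /=; case: s => k /=.
- by rewrite !mul0mx mulmx0 if_same !addr0 raddf0.
- rewrite mul0mx if_same addr0 !big_ord_recl big_ord0 addr0 /= -!scalar_mxM -!raddfD /=.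
  congr _%:M; rewrite -[_ == inr _]/(k == j).
  case: j => [[|[|[|//]]] ?]; case: k => [[|[|[|//]]] ?] /=;
    by rewrite ?mulr1n ?mulr0n ?mulr1 ?mulr0 ?addr0 ?add0r.
- rewrite !mul0mx addr0 add0r mulmx1 -[_ == inl _]/(k == i) eq_sym.
  by case: eqVneq; rewrite ?raddf0.
- by rewrite mulmx0 if_same !mul0mx big1 ?addr0 ?raddf0 // => b _; rewrite mul0mx.
Qed.

(** * The characteristic test and the final network *)

Definition undecodable : pattern :=
  @Pattern unit void unit (fun _ _ => false) (fun _ _ => false) id.

(** The only source of [undecodable] plays h: it can reach its terminal only through the gadget.
    Dimension 0 is excluded, as there 0 is the identity. *)
Lemma solvable_gadget_undecodable n d (F : fieldType) :
  solvable (gadget n undecodable) d.+1 F <-> n%:R = 0 :> F.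
Proof.
split=> [sol|n0]; last first.
  apply: (@gadget_solvable n undecodable _ F (fun=> fun=> 0) (fun=> fun=> 0)
    (fun=> 1%:M) (fun=> 1%:M)) => [_|[] []]; first by rewrite -scaler_nat n0 scale0r.
  by rewrite big_pred0 ?mulmx1 ?add0r // => -[].
apply/eqP; apply/negP=> /negP/solvable_gadget/(_ sol)[G [D /(_ tt tt)]].
rewrite big_pred0 => [/esym/matrixP/(_ ord0 ord0)|[]].
by rewrite !mxE => /eqP; rewrite oner_eq0.
Qed.

Lemma natr_prod_pchar (P : seq nat) (F : fieldType) : all prime P ->
  (\prod_(p <- P) p)%:R = 0 :> F <-> exists2 p : nat, p \in P & p \in [pchar F].
Proof.
move=> /allP P_prime; rewrite natr_prod; split.
  move/eqP; rewrite prodf_seq_eq0 => /hasP[p pP /= p0].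
  by exists p => //; rewrite inE P_prime.
by move=> [p pP /andP[_ /eqP p0]]; rewrite (big_rem p) //= p0 mul0r.
Qed.

Theorem theorem3 (P1 P2 : seq nat) :
  all prime P1 -> all prime P2 -> P1 != [::] -> P2 != [::] ->
  exists N : network,
    wf_network N /\ solvability_chars N 2 P1 /\ solvability_chars N 3 (P1 ++ P2).
Proof.
move=> P1_prime P2_prime _ _.
have P12_prime : all prime (P1 ++ P2) by rewrite all_cat P1_prime.
pose n1 := \prod_(p <- P1) p; pose n12 := \prod_(p <- P1 ++ P2) p.
pose B := punion (gadget n1 base3) (gadget n12 undecodable).
exists (net B); split; first exact: net_wf.
have netE d (F : finFieldType) : has_vlnc_solution (net B) d.+1 F <->
    solvable (gadget n1 base3) d.+1 F /\ n12%:R = 0 :> F.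
  split=> [/net_solvable/solvable_union[sol /solvable_gadget_undecodable n120] //|].
  move=> [sol /solvable_gadget_undecodable sol'].
  by apply/solvable_net/solvable_union.
(* In dimension 2 the [base3] part forces [n1] to vanish, and then so does its multiple [n12]. In
   dimension 3 that part is solvable with the gadget ignored, leaving the condition on [n12]. *)
split=> F; split.
- move=> /netE[sol _]; apply/(natr_prod_pchar _ P1_prime)/eqP/negP=> /negP n10.
  exact: (solvable_base3_dim2 (solvable_gadget n10 sol)).
- move=> /(natr_prod_pchar _ P1_prime) n10; apply/netE.
  by split; [exact: gadget_base3_solvable|rewrite /n12 big_cat natrM n10 mul0r].
- by move=> /netE[_ /(natr_prod_pchar _ P12_prime)].
- move=> /(natr_prod_pchar _ P12_prime) n120; apply/netE; split=> //.
  have [G [D GD]] := base3_solvable3 F.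
  apply: (@gadget_solvable _ base3 3 F G D (fun=> 0) (fun=> 0)) => [t|t s].
    exact: mul0rn.
  by rewrite mulmx0 addr0 GD.
Qed.
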